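(* If $p$ is a quaternary quartic form (a homogeneous real polynomial of degree $4$ in $4$ variables), not constant on the unit sphere (so that $\mathrm{gap}(p)$ is defined), then $\mathrm{gap}(p)\le 2$.
   Context: For a form (homogeneous real polynomial) $p$ of degree $2d$ in $n$ variables, $p_{\min}=\min_{\|x\|=1}p(x)$ and $p_{\max}=\max_{\|x\|=1}p(x)$ are its minimum and maximum on the Euclidean unit sphere of $\mathbb{R}^n$, $$p_{\min}^{\mathrm{sos}}=\max\{\gamma\in\mathbb{R} : p(x)-\gamma\|x\|^{2d}\text{ is a sum of squares of real polynomials}\},$$ and, when $p_{\max}>p_{\min}$, $$\mathrm{gap}(p)=\frac{p_{\max}-p_{\min}^{\mathrm{sos}}}{p_{\max}-p_{\min}}.$$ *)

(* Defs.v *)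
From mathcomp Require Import all_boot all_order all_algebra.
From mathcomp Require Import classical_sets reals.
From mathcomp Require Import mpoly.

Set Implicit Arguments.
Unset Strict Implicit.
Unset Printing Implicit Defensive.

Import Order.TTheory GRing.Theory Num.Theory.

Local Open Scope ring_scope.
Local Open Scope classical_set_scope.

Definition euclidean_norm (R : realType) (n : nat) (x : 'I_n -> R) : R :=
  Num.sqrt (\sum_(i < n) x i ^+ 2).

Definition unit_sphere (R : realType) (n : nat) : set ('I_n -> R) :=
  [set x | euclidean_norm x = 1].

(* On a nonempty sphere the infimum and the supremum are attained, by
   compactness, so they are the minimum and the maximum of p. *)
Definition sphere_min (R : realType) (n : nat) (p : {mpoly R[n]}) : R :=
  inf [set p.@[x] | x in @unit_sphere R n].

Definition sphere_max (R : realType) (n : nat) (p : {mpoly R[n]}) : R :=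
  sup [set p.@[x] | x in @unit_sphere R n].

Definition is_sos (R : realType) (n : nat) (p : {mpoly R[n]}) : Prop :=
  exists qs : seq {mpoly R[n]}, p = \sum_(q <- qs) q ^+ 2.

(* The polynomial ||x||^2. *)
Definition sqnorm_poly (R : realType) (n : nat) : {mpoly R[n]} :=
  \sum_(i < n) 'X_i ^+ 2.

(* For n > 0 and p homogeneous of degree 2d, the set below is nonempty, bounded
   above by sphere_min p and, the cone of sums of squares being closed, closed:
   the supremum is a maximum. *)
Definition sos_min (R : realType) (n d : nat) (p : {mpoly R[n]}) : R :=
  sup [set gamma : R | is_sos (p - gamma *: sqnorm_poly R n ^+ d)].

(* Meaningful for p homogeneous of degree 2d with sphere_min p < sphere_max p. *)
Definition gap (R : realType) (n d : nat) (p : {mpoly R[n]}) : R :=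
  (sphere_max p - sos_min d p) / (sphere_max p - sphere_min p).

(* Main.v *)
Require Import Defs.
From mathcomp Require Import all_boot all_order all_algebra.
From mathcomp Require Import classical_sets reals.

(* Let [e] be a point of the unit sphere where the
   quartic [f] attains its minimum [mu], let [D] be the maximum of [f - mu], and
   write [x = t e + y] with [y] orthogonal to [e] and [r = |y|]. Minimality makes
   [f = mu t^4 + t^2 A(y) + t B(y) + C(y)] with [A - 2 mu r^2] nonnegative, hence
   a sum of squares, and [|B| <= (8 sqrt 3 / 9) D r^3]. By Bernstein's inequality
   [B = sum_i y_i b_i] with [sum_i b_i^2 <= (64 / 27) D^2 r^4], and
     [f = mu (t^2 - r^2 / 3)^2 + t^2 (A - 2 mu r^2)
          + (8 mu / 3) sum_i (t y_i + 3 b_i / (16 mu))^2 + h(y)]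
   where the quartic [h] in one variable less takes values in
   [8 mu / 9 - 2 D^2 / (9 mu), 8 mu / 9 + D] on the sphere. Inductively, a
   nonnegative [f] is a sum of squares as soon as [k (max f - min f) <= min f],
   where [k] is [0] for 2 variables, [1 / 2] for 3 and [1] for 4; in 2 variables
   [f - mu |x|^4] is [y^2] times a binary quadratic form. The theorem is the case
   of [p - (2 p_min - p_max) |x|^4], whose values range over [D, 2 D] for
   [D = p_max - p_min]. *)

Set Implicit Arguments.
Unset Strict Implicit.
Unset Printing Implicit Defensive.

Import Order.TTheory GRing.Theory Num.Theory.

Local Open Scope ring_scope.

(** * Minima of polynomials on the sphere *)

Module SphereMin.
From mathcomp Require Import boolp topology normedtype derive realfun.
Import numFieldNormedType.Exports.
Local Open Scope classical_set_scope.

(** The sphere is closed and bounded in finite dimension, hence compact, and [f] is continuous. The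
    explicit sum of monomials lets continuity be built up from the coordinates. *)
Lemma polynomial_min_on_sphere (R : realType) (n : nat) (I : Type) (r : seq I)
    (c : I -> R) (k : I -> 'I_n.+1 -> nat) (f : 'rV[R]_n.+1 -> R) :
  (forall x, f x = \sum_(a <- r) c a * \prod_i x ord0 i ^+ k a i) ->
  exists2 e : 'rV[R]_n.+1, \sum_i e ord0 i ^+ 2 = 1 &
    forall x : 'rV[R]_n.+1, \sum_i x ord0 i ^+ 2 = 1 -> f e <= f x.
Proof.
move=> fE.
have coordX_cont (i : 'I_n.+1) m :
    continuous (fun x : 'rV[R]_n.+1 => x ord0 i ^+ m).
  move=> x; apply: (@continuous_comp _ _ _ (fun x : 'rV[R]_n.+1 => x ord0 i)
    (fun y : R => y ^+ m)).
    exact: coord_continuous.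
  exact: exprn_continuous.
have add_cont : continuous (fun z : R * R => z.1 + z.2).
  by move=> z; apply: cvgD; [exact: cvg_fst|exact: cvg_snd].
have mul_cont : continuous (fun z : R * R => z.1 * z.2).
  by move=> z; apply: cvgM; [exact: cvg_fst|exact: cvg_snd].
have f_cont : continuous f.
  rewrite (_ : f = fun x => \sum_(a <- r) c a * \prod_i x ord0 i ^+ k a i);
    last by apply/funext => x; exact: fE.
  apply: (@continuous_big R _ +%R 0 xpredT add_cont) => a _.
  have prod_cont : continuous (fun x : 'rV[R]_n.+1 => \prod_i x ord0 i ^+ k a i).
    by apply: (@continuous_big R _ *%R 1 xpredT mul_cont) => i _; exact: coordX_cont.
  by move=> x; apply: cvgMr; [exact: nbhs_filter|exact: prod_cont].
have sq_cont : continuous (fun x : 'rV[R]_n.+1 => \sum_i x ord0 i ^+ 2).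
  by apply: (@continuous_big R _ +%R 0 xpredT add_cont) => i _; exact: coordX_cont.
pose S := [set x : 'rV[R]_n.+1 | \sum_i x ord0 i ^+ 2 = 1].
have S0 : S !=set0.
  exists (delta_mx ord0 ord0); rewrite /S /= (bigD1 ord0) //= mxE !eqxx expr1n.
  rewrite big1 ?addr0 // => i /negPf i0.
  by rewrite mxE i0 andbF expr0n.
have S_closed : closed S.
  by apply: (preimage_closed _ (@closed_eq R 1)) => x _; exact: sq_cont.
have S_bounded : bounded_set S.
  exists 1; split; first exact: real1.
  move=> M M1 x Sx /=; rewrite [leLHS]/Num.Def.normr /= mx_normrE.
  apply: bigmax_le => [|[i j] _ /=]; first exact: le_trans (ltW M1).
  apply: le_trans (ltW M1); rewrite (ord1 i) -(@ler_pXn2r _ 2%N) ?nnegrE // expr1n.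
  rewrite real_normK ?num_real // -Sx (bigD1 j) //= lerDl.
  by apply: sumr_ge0 => l _; exact: sqr_ge0.
have [e eS emin] := EVT_min_rV S0 (bounded_closed_compact S_bounded S_closed)
  (continuous_subspaceT f_cont).
exists e; first by move: eS; rewrite inE.
by move=> x Sx; apply: emin; rewrite inE.
Qed.

End SphereMin.

From mathcomp Require Import mpoly ring lra.

(** * Cubics in one variable, trisection of an angle, binary cubic forms *)

(** At a large argument the leading term decides the sign. The use below is to [f - mu |x| ^ 4]
    along a line parallel to [e], where the terms in [t ^ 4] cancel. *)
Lemma cubic_nonneg_coefs (R : realFieldType) (a b c d : R) :
  (forall t, 0 <= a * t ^+ 3 + b * t ^+ 2 + c * t + d) -> a = 0 /\ 0 <= b.
Proof.
have no_neg (u v w z : R) : u < 0 ->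
    exists2 t, 0 < t & u * t ^+ 3 + v * t ^+ 2 + w * t + z < 0.
  move=> u_lt0; pose K := `|v| + `|w| + `|z|.
  have K_ge0 : 0 <= K by rewrite !addr_ge0.
  (* This [t] is at least 1 and gives [u t = u - K], so [u t ^ 3 = u t ^ 2 - K t ^ 2], where
     [K t ^ 2] absorbs the lower terms. *)
  pose t := 1 + K / (- u); exists t.
    by rewrite ltr_pwDl // divr_ge0 // oppr_ge0 ltW.
  have utK : u * t = u - K by rewrite /t; field; rewrite lt_eqF.
  have t_ge1 : 1 <= t by rewrite lerDl divr_ge0 // oppr_ge0 ltW.
  have t2_ge : t <= t ^+ 2 by rewrite expr2 ler_peMl // (le_trans ler01).
  have -> : u * t ^+ 3 = u * t * t ^+ 2 by ring.
  rewrite utK.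
  have v_le := ler_norm v; have w_le := ler_norm w; have z_le := ler_norm z.
  have vt : v * t ^+ 2 <= `|v| * t ^+ 2 by rewrite ler_wpM2r ?sqr_ge0.
  have t_ge0 : 0 <= t by rewrite (le_trans ler01).
  have wt : w * t <= `|w| * t ^+ 2.
    by rewrite (le_trans (ler_wpM2r t_ge0 w_le)) // ler_wpM2l.
  have zt : z <= `|z| * t ^+ 2.
    by rewrite (le_trans z_le) // ler_peMr // (le_trans t_ge1).
  have ut : u * t ^+ 2 < 0 by rewrite nmulr_rlt0 // exprn_gt0 // (lt_le_trans ltr01).
  by rewrite /K; lra.
move=> abcd_ge0.
have a0 : a = 0.
  have [a_lt0|a_gt0|//] := ltgtP a 0.
    have [t _] := no_neg a b c d a_lt0.
    by rewrite ltNge abcd_ge0.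
  have Na_lt0 : - a < 0 by rewrite oppr_lt0.
  have [t _] := no_neg (- a) b (- c) d Na_lt0.
  have -> : - a * t ^+ 3 + b * t ^+ 2 + - c * t + d =
      a * (- t) ^+ 3 + b * (- t) ^+ 2 + c * (- t) + d by ring.
  by rewrite ltNge abcd_ge0.
split=> //; rewrite leNgt; apply/negP => b_lt0.
(* With [a = 0], multiplication by [t > 0] raises the degree and makes [b] the leading coefficient
   of a cubic. *)
have [t t_gt0] := no_neg b c d 0 b_lt0.
have := mulr_ge0 (abcd_ge0 t) (ltW t_gt0).
have -> : (a * t ^+ 3 + b * t ^+ 2 + c * t + d) * t =
    b * t ^+ 3 + c * t ^+ 2 + d * t + 0 by rewrite a0; ring.
by rewrite leNgt => /negP.
Qed.

(** [(p, q)] and [(x, y)] are the cosine and sine of an angle and of its triple. *)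
Lemma trisection (R : rcfType) (x y : R) : x ^+ 2 + y ^+ 2 = 1 ->
  exists p q : R, [/\ p ^+ 2 + q ^+ 2 = 1, 4 * p ^+ 3 - 3 * p = x
    & 3 * q - 4 * q ^+ 3 = y].
Proof.
move=> xy1.
have x_le1 : -1 <= x <= 1 by nra.
(* [4 t ^ 3 - 3 t] runs from -1 at [t = 1 / 2] to 1 at [t = 1], so the intermediate value theorem
   gives [p]; then [q] is a square root of [1 - p ^ 2] with the sign chosen to match [y]. *)
pose P : {poly R} := 4 *: 'X^3 - 3 *: 'X - x%:P.
have PE t : P.[t] = 4 * t ^+ 3 - 3 * t - x by rewrite /P !hornerE.
have half_le1 : 1 / 2 <= 1 :> R by lra.
have P01 : P.[1 / 2] <= 0 <= P.[1] by rewrite !PE; apply/andP; split; lra.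
have [p /andP[p_ge p_le] /rootP] := poly_ivt half_le1 P01.
rewrite PE => p_root.
have p2 : 0 <= 1 - p ^+ 2 by nra.
have sqr_q := sqr_sqrtr p2.
set q := Num.sqrt _ in sqr_q.
have : (3 * q - 4 * q ^+ 3) ^+ 2 = y ^+ 2.
  have -> : y ^+ 2 = 1 - (4 * p ^+ 3 - 3 * p) ^+ 2.
    have -> : 4 * p ^+ 3 - 3 * p = x by lra.
    lra.
  have -> : (3 * q - 4 * q ^+ 3) ^+ 2 = q ^+ 2 * (3 - 4 * q ^+ 2) ^+ 2 by ring.
  rewrite sqr_q; ring.
move/eqP; rewrite eqf_sqr => /orP[] /eqP qy.
  by exists p, q; split; lra.
by exists p, (- q); split; rewrite ?sqrrN; try lra; rewrite exprNn; nra.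
Qed.

(* If [(a, b)] has angle [3 chi] and length [rho], then [rho] is the combination of
   the values of the cubic form at the angles [chi], [chi + pi / 3], [chi - pi / 3]
   (the second and third negated) with the weights
   [((4 cos^2 theta - 1) / 3) ^ 2], which sum to 1. *)
Lemma bernstein_cubic (R : rcfType) (a b c d beta : R) :
  (forall s t, s ^+ 2 + t ^+ 2 = 1 ->
    `|a * s ^+ 3 + 3 * b * s ^+ 2 * t + 3 * c * s * t ^+ 2 + d * t ^+ 3| <= beta) ->
  a ^+ 2 + b ^+ 2 <= beta ^+ 2.
Proof.
move=> f_le.
pose f s t :=
  a * s ^+ 3 + 3 * b * s ^+ 2 * t + 3 * c * s * t ^+ 2 + d * t ^+ 3.
have [ab0|ab_neq0] := eqVneq (a ^+ 2 + b ^+ 2) 0.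
  by rewrite ab0 sqr_ge0.
have ab_gt0 : 0 < a ^+ 2 + b ^+ 2 by rewrite lt_def ab_neq0 addr_ge0 ?sqr_ge0.
pose rho := Num.sqrt (a ^+ 2 + b ^+ 2).
have rho_gt0 : 0 < rho by rewrite sqrtr_gt0.
have rho2 : rho ^+ 2 = a ^+ 2 + b ^+ 2 by rewrite sqr_sqrtr ?ltW.
have [p [q [pq1 pE qE]]] : exists p q : R, [/\ p ^+ 2 + q ^+ 2 = 1,
    4 * p ^+ 3 - 3 * p = a / rho & 3 * q - 4 * q ^+ 3 = b / rho].
  by apply: trisection; rewrite !expr_div_n -mulrDl rho2 divff.
pose r : R := Num.sqrt 3.
have r2 : r ^+ 2 = 3 by rewrite sqr_sqrtr // ler0n.
pose l (x : R) := ((4 * x ^+ 2 - 1) / 3) ^+ 2.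
(* The point [(p, q)] turned by [pi / 3], then by [- pi / 3]. *)
pose x1 := (p - r * q) / 2; pose y1 := (q + r * p) / 2.
pose x2 := (p + r * q) / 2; pose y2 := (q - r * p) / 2.
have xy1 : x1 ^+ 2 + y1 ^+ 2 = 1.
  transitivity ((p ^+ 2 + q ^+ 2) * (1 + r ^+ 2) / 4).
    by rewrite /x1 /y1; field.
  by rewrite pq1 r2; field.
have xy2 : x2 ^+ 2 + y2 ^+ 2 = 1.
  transitivity ((p ^+ 2 + q ^+ 2) * (1 + r ^+ 2) / 4).
    by rewrite /x2 /y2; field.
  by rewrite pq1 r2; field.
(* Replacing [r] by [- r] interchanges the two turned points. Each computation is made once, for any
   [e] with [e ^ 2 = 3]: [M], [N] for [l], and [F], [G] for [f], separate the part free of [e] from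
   the multiple of [e]. *)
pose M := 4 / 9 * q ^+ 2 * (q ^+ 2 + 3 * p ^+ 2).
pose N := 8 / 9 * p * q ^+ 3.
have l0E : l p = ((3 * p ^+ 2 - q ^+ 2) / 3) ^+ 2.
  by congr ((_ / _) ^+ 2); lra.
have sqE (e : R) : e ^+ 2 = 3 -> l ((p - e * q) / 2) = M - e * N.
  move=> e2; transitivity (((2 * q ^+ 2 - 2 * e * p * q) / 3) ^+ 2).
    congr ((_ / _) ^+ 2).
    have -> : 4 * ((p - e * q) / 2) ^+ 2 =
      p ^+ 2 - 2 * e * p * q + e ^+ 2 * q ^+ 2 by field.
    by rewrite e2; lra.
  rewrite /M /N.
  have -> : ((2 * q ^+ 2 - 2 * e * p * q) / 3) ^+ 2 =
    4 / 9 * q ^+ 2 * (q ^+ 2 - 2 * e * p * q + e ^+ 2 * p ^+ 2) by field.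
  by rewrite e2; field.
pose F := (a * (p ^+ 3 + 9 * p * q ^+ 2) + 3 * b * (3 * q ^+ 3 - 5 * p ^+ 2 * q)
  + 3 * c * (3 * p ^+ 3 - 5 * p * q ^+ 2) + d * (q ^+ 3 + 9 * q * p ^+ 2)) / 8.
pose G := 3 / 8 * ((b + d) * p - (a + c) * q) * (p ^+ 2 + q ^+ 2).
have fE (e : R) : e ^+ 2 = 3 ->
    f ((p - e * q) / 2) ((q + e * p) / 2) = F + e * G.
  move=> e2.
  have e3 : e ^+ 3 = 3 * e by rewrite exprS e2 mulrC.
  transitivity ((
      a * (p ^+ 3 - 3 * p ^+ 2 * e * q + 3 * p * e ^+ 2 * q ^+ 2
           - e ^+ 3 * q ^+ 3)
    + 3 * b * (p ^+ 2 * q - 2 * e * p * q ^+ 2 + e ^+ 2 * q ^+ 3 + e * p ^+ 3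
               - 2 * e ^+ 2 * p ^+ 2 * q + e ^+ 3 * p * q ^+ 2)
    + 3 * c * (p * q ^+ 2 + 2 * e * p ^+ 2 * q + e ^+ 2 * p ^+ 3 - e * q ^+ 3
               - 2 * e ^+ 2 * p * q ^+ 2 - e ^+ 3 * p ^+ 2 * q)
    + d * (q ^+ 3 + 3 * q ^+ 2 * e * p + 3 * q * e ^+ 2 * p ^+ 2
           + e ^+ 3 * p ^+ 3)) / 8).
    by rewrite /f; field.
  by rewrite e3 e2 /F /G; field.
have Nr2 : (- r) ^+ 2 = 3 by rewrite sqrrN.
have x2E : x2 = (p - - r * q) / 2 by rewrite mulNr opprK.
have y2E : y2 = (q + - r * p) / 2 by rewrite mulNr.
have l1E : l x1 = M - r * N by exact: sqE.
have l2E : l x2 = M + r * N by rewrite x2E sqE // mulNr opprK.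
have f1E : f x1 y1 = F + r * G by exact: fE.
have f2E : f x2 y2 = F - r * G by rewrite x2E y2E fE // mulNr.
have sum_l : l p + l x1 + l x2 = 1.
  transitivity ((p ^+ 2 + q ^+ 2) ^+ 2); last by rewrite pq1 expr1n.
  by rewrite l0E l1E l2E /M; field.
have rhoE : rho = l p * f p q - l x1 * f x1 y1 - l x2 * f x2 y2.
  have -> : rho = a * (4 * p ^+ 3 - 3 * p) + b * (3 * q - 4 * q ^+ 3).
    rewrite pE qE; apply: (mulIf (lt0r_neq0 rho_gt0)).
    by rewrite -expr2 rho2; field; rewrite lt0r_neq0.
  (* Factors [p ^ 2 + q ^ 2 = 1] make both sides homogeneous of degree 7 in [p] and [q]; what
     remains is a polynomial identity. *)
  have -> : 4 * p ^+ 3 - 3 * p =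
      (p ^+ 2 + q ^+ 2) ^+ 2 * (4 * p ^+ 3 - 3 * p * (p ^+ 2 + q ^+ 2)).
    by rewrite pq1; ring.
  have -> : 3 * q - 4 * q ^+ 3 =
      (p ^+ 2 + q ^+ 2) ^+ 2 * (3 * q * (p ^+ 2 + q ^+ 2) - 4 * q ^+ 3).
    by rewrite pq1; ring.
  transitivity (l p * f p q - 2 * M * F + 2 * r ^+ 2 * N * G).
    by rewrite r2 l0E /f /M /N /F /G; field.
  by rewrite l1E l2E f1E f2E; ring.
have := f_le _ _ pq1; have := f_le _ _ xy1; have := f_le _ _ xy2.
rewrite !ler_norml -!/(f _ _) => /andP[f2 f2'] /andP[f1 f1'] /andP[f0 f0'].
have l_ge0 x : 0 <= l x by exact: sqr_ge0.
have rho_le : rho <= beta.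
  rewrite rhoE -[leRHS]mul1r -sum_l !mulrDl.
  have := ler_wpM2l (l_ge0 p) f0'.
  have := ler_wpM2l (l_ge0 x1) f1; have := ler_wpM2l (l_ge0 x2) f2.
  by rewrite !mulrN; lra.
by rewrite -rho2 ler_pXn2r // ?nnegrE ?ltW // (lt_le_trans rho_gt0).
Qed.

(** * Linear functionals and the scalar product *)

Section Scalar.
Context (R : realType) (n : nat) (f : 'rV[R]_n -> R).
Hypothesis f_lin : scalar f.

Lemma scalar_fun0 : f 0 = 0.
Proof. by have := f_lin (- 1) 0 0; rewrite scaler0 addr0 mulN1r addNr. Qed.

Lemma scalar_funZ a u : f (a *: u) = a * f u.
Proof. by have := f_lin a u 0; rewrite !addr0 scalar_fun0 addr0. Qed.

Lemma scalar_fun_sum_delta x : f x = \sum_i x 0 i * f (delta_mx 0 i).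
Proof.
rewrite {1}[x]row_sum_delta.
by elim/big_rec2: _ => [|i y u _ <-]; [exact: scalar_fun0|exact: f_lin].
Qed.

End Scalar.

Definition dot (R : realType) (n : nat) (x y : 'rV[R]_n) : R := (x *m y^T) 0 0.

Section Dot.
Context (R : realType) (n : nat).
Implicit Types x y : 'rV[R]_n.

Lemma dotE x y : dot x y = \sum_i x 0 i * y 0 i.
Proof. by rewrite /dot mxE; apply: eq_bigr => i _; rewrite mxE. Qed.

Lemma dotC x y : dot x y = dot y x.
Proof. by rewrite !dotE; apply: eq_bigr => i _; rewrite mulrC. Qed.

Lemma dot_scalar y : scalar (fun x => dot x y).
Proof. by move=> a u v; rewrite /dot mulmxDl -scalemxAl !mxE. Qed.

Lemma dot_scalarr x : scalar (dot x).
Proof. by move=> a u v; rewrite ![dot x _]dotC dot_scalar. Qed.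

Lemma dotxxE x : dot x x = \sum_i x 0 i ^+ 2.
Proof. by rewrite dotE; apply: eq_bigr => i _; rewrite expr2. Qed.

Lemma dotxx_ge0 x : 0 <= dot x x.
Proof. by rewrite dotxxE sumr_ge0 // => i _; exact: sqr_ge0. Qed.

Lemma dotxx_eq0 x : dot x x = 0 -> x = 0.
Proof.
rewrite dotxxE => /eqP; rewrite psumr_eq0; last by move=> i _; exact: sqr_ge0.
move=> /allP x0; apply/rowP => i; rewrite mxE.
by apply/eqP; rewrite -sqrf_eq0; apply: (x0 i); rewrite mem_index_enum.
Qed.

Lemma dot_delta x i : dot x (delta_mx 0 i) = x 0 i.
Proof.
rewrite dotE (bigD1 i) //= mxE !eqxx mulr1 big1 ?addr0 // => j /negPf ji.
by rewrite mxE ji andbF mulr0.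
Qed.

Lemma dotZZ a x : dot (a *: x) (a *: x) = a ^+ 2 * dot x x.
Proof.
by rewrite (scalar_funZ (dot_scalar _)) (scalar_funZ (dot_scalarr _)) mulrA expr2.
Qed.

Lemma scale_unit x : x != 0 ->
  exists2 u, dot u u = 1 & x = Num.sqrt (dot x x) *: u.
Proof.
move=> x_neq0; set r := Num.sqrt _.
have r2 : r ^+ 2 = dot x x by rewrite sqr_sqrtr ?dotxx_ge0.
have r_neq0 : r != 0.
  by apply: contra_neq x_neq0 => r0; apply: dotxx_eq0; rewrite -r2 r0 expr0n.
exists (r^-1 *: x); last by rewrite scalerA divff // scale1r.
by rewrite dotZZ -r2 -exprMn mulVf // expr1n.
Qed.

End Dot.

(** * Polynomial functions and their sums of squares *)

(** Polynomials are handled through their values on row vectors, so that a change of coordinates is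
    a product with a matrix; [sosfun_is_sos] returns to polynomials. *)
Definition polyfun (R : realType) (n : nat) (f : 'rV[R]_n -> R) : Prop :=
  exists P : {mpoly R[n]}, forall x, f x = P.@[x 0].

Definition sosfun (R : realType) (n : nat) (f : 'rV[R]_n -> R) : Prop :=
  exists s : seq {mpoly R[n]}, forall x, f x = \sum_(q <- s) q.@[x 0] ^+ 2.

Section PolyFun.
Context (R : realType).
Implicit Types n : nat.

Lemma polyfun_ext n (f g : 'rV[R]_n -> R) : f =1 g -> polyfun f -> polyfun g.
Proof. by move=> fg [P fP]; exists P => x; rewrite -fg. Qed.

Lemma polyfun_cst n (c : R) : polyfun (fun _ : 'rV[R]_n => c).
Proof. by exists c%:MP => x; rewrite mevalC. Qed.

Lemma polyfun_coord n i : polyfun (fun x : 'rV[R]_n => x 0 i).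
Proof. by exists 'X_i => x; rewrite mevalXU. Qed.

Lemma polyfunD n (f g : 'rV[R]_n -> R) :
  polyfun f -> polyfun g -> polyfun (fun x => f x + g x).
Proof. by move=> [P fP] [Q gQ]; exists (P + Q) => x; rewrite mevalD fP gQ. Qed.

Lemma polyfunM n (f g : 'rV[R]_n -> R) :
  polyfun f -> polyfun g -> polyfun (fun x => f x * g x).
Proof. by move=> [P fP] [Q gQ]; exists (P * Q) => x; rewrite mevalM fP gQ. Qed.

Lemma polyfun_sum n (I : Type) (r : seq I) (f : I -> 'rV[R]_n -> R) :
  (forall i, polyfun (f i)) -> polyfun (fun x => \sum_(i <- r) f i x).
Proof.
move=> f_poly; elim: r => [|i r IHr].
  by apply: polyfun_ext (polyfun_cst n 0) => x; rewrite big_nil.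
by apply: polyfun_ext (polyfunD (f_poly i) IHr) => x; rewrite big_cons.
Qed.

(* Peels off one slot of a multilinear form; the remaining ones go to [y]. *)
Lemma polyfun_scalar n (f : 'rV[R]_n -> 'rV[R]_n -> R) :
    (forall y, scalar (f^~ y)) -> (forall i, polyfun (f (delta_mx 0 i))) ->
  polyfun (fun x => f x x).
Proof.
move=> f_lin f_poly.
have := polyfun_sum (index_enum 'I_n)
  (fun i => polyfunM (polyfun_coord i) (f_poly i)).
by apply: polyfun_ext => x; rewrite -(scalar_fun_sum_delta (f_lin x)).
Qed.

Lemma meval_mulmx n m (U : 'M[R]_(n, m)) (P : {mpoly R[m]}) :
  exists Q : {mpoly R[n]}, forall x : 'rV_n, P.@[(x *m U) 0] = Q.@[x 0].
Proof.
exists (P \mPo [tuple \sum_j U j i *: 'X_j | i < m]) => x.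
rewrite comp_mpoly_meval; apply: meval_eq => i.
rewrite tnth_mktuple mxE raddf_sum /=; apply: eq_bigr => j _.
by rewrite mevalZ mevalXU mulrC.
Qed.

Lemma sosfun_ext n (f g : 'rV[R]_n -> R) : f =1 g -> sosfun f -> sosfun g.
Proof. by move=> fg [s fs]; exists s => x; rewrite -fg. Qed.

Lemma sosfun0 n : sosfun (fun _ : 'rV[R]_n => 0).
Proof. by exists [::] => x; rewrite big_nil. Qed.

Lemma sosfunD n (f g : 'rV[R]_n -> R) :
  sosfun f -> sosfun g -> sosfun (fun x => f x + g x).
Proof.
by move=> [s fs] [t gt]; exists (s ++ t) => x; rewrite big_cat /= fs gt.
Qed.

Lemma sosfun_sum n (I : Type) (r : seq I) (f : I -> 'rV[R]_n -> R) :
  (forall i, sosfun (f i)) -> sosfun (fun x => \sum_(i <- r) f i x).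
Proof.
move=> f_sos; elim: r => [|i r IHr].
  by apply: sosfun_ext (sosfun0 n) => x; rewrite big_nil.
by apply: sosfun_ext (sosfunD (f_sos i) IHr) => x; rewrite big_cons.
Qed.

Lemma sosfun_sqrM n (f g : 'rV[R]_n -> R) :
  polyfun f -> sosfun g -> sosfun (fun x => f x ^+ 2 * g x).
Proof.
move=> [P fP] [s gs]; exists [seq P * q | q <- s] => x.
rewrite big_map gs mulr_sumr; apply: eq_bigr => q _.
by rewrite mevalM fP exprMn.
Qed.

Lemma sosfun_cst n (c : R) : 0 <= c -> sosfun (fun _ : 'rV[R]_n => c).
Proof.
move=> c_ge0; exists [:: (Num.sqrt c)%:MP] => x.
by rewrite big_seq1 mevalC sqr_sqrtr.
Qed.

Lemma sosfun_sqr n c (f : 'rV[R]_n -> R) :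
  0 <= c -> polyfun f -> sosfun (fun x => c * f x ^+ 2).
Proof.
move=> c_ge0 f_poly; apply: sosfun_ext (sosfun_sqrM f_poly (sosfun_cst n c_ge0)).
by move=> x; rewrite mulrC.
Qed.

Lemma sosfun_mulmx n m (U : 'M[R]_(n, m)) (f : 'rV[R]_m -> R) :
  sosfun f -> sosfun (fun x => f (x *m U)).
Proof.
move=> [s fs].
suff [t st] : exists t : seq {mpoly R[n]}, forall x : 'rV_n,
    \sum_(q <- s) q.@[(x *m U) 0] ^+ 2 = \sum_(q <- t) q.@[x 0] ^+ 2.
  by exists t => x; rewrite fs st.
elim: s {fs} => [|P s [t st]]; first by exists [::] => x; rewrite !big_nil.
have [Q PQ] := meval_mulmx U P.
by exists (Q :: t) => x; rewrite !big_cons PQ st.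
Qed.

End PolyFun.

Lemma polyfun_mulmx (R : realType) n m (U : 'M[R]_(n, m)) (f : 'rV[R]_m -> R) :
  polyfun f -> polyfun (fun x => f (x *m U)).
Proof.
move=> [P fP]; have [Q PQ] := meval_mulmx U P.
by exists Q => x; rewrite fP PQ.
Qed.

Lemma polyfun_dot (R : realType) n (y : 'rV[R]_n) : polyfun (fun x => dot x y).
Proof.
apply: (@polyfun_scalar _ _ (fun x _ => dot x y)) => [_|i].
  exact: dot_scalar.
exact: polyfun_cst.
Qed.

Lemma polyfun_dotxx (R : realType) n : polyfun (fun x : 'rV[R]_n => dot x x).
Proof.
apply: (@polyfun_scalar _ _ (@dot R n)) => [y|i]; first exact: dot_scalar.
by apply: polyfun_ext (polyfun_dot (delta_mx 0 i)) => x; rewrite dotC.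
Qed.

(** * Orthonormal changes of coordinates *)

(* Splits R^(n+1) as the line of [e] plus the image of the isometry
   [y |-> y *m U] onto the orthogonal complement of [e]. *)
Definition orth_split (R : realType) (n : nat) (e : 'rV[R]_n.+1)
    (U : 'M[R]_(n, n.+1)) : Prop :=
  [/\ U *m U^T = 1%:M, U *m e^T = 0 & e^T *m e + U^T *m U = 1%:M].

(** [U] consists of the rows after the first of an orthogonal matrix [H] with first row [e]; the
    blocks of [H H^T = 1] and [H^T H = 1] contain the three equations. [H] is the Householder
    reflection exchanging [e] with the first basis vector, or the identity if these coincide. *)
Lemma orth_split_exists (R : realType) (n : nat) (e : 'rV[R]_n.+1) :
  dot e e = 1 -> exists U, orth_split e U.
Proof.
move=> e1.
suff [H [HH HH' He]] : exists H : 'M[R]_(1 + n),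
    [/\ H *m H^T = 1%:M, H^T *m H = 1%:M & usubmx H = e].
  pose U := dsubmx H.
  have HE : H = col_mx e U by rewrite -He vsubmxK.
  move: HH'; rewrite HE tr_col_mx mul_row_col => eU.
  move: HH; rewrite HE tr_col_mx mul_col_row (@scalar_mx_block R 1 n 1).
  move=> /eq_block_mx[_ _ Ue UU].
  by exists U; split.
pose e0 : 'rV[R]_(1 + n) := delta_mx 0 0.
have [->|e_neq] := eqVneq e e0.
  exists 1%:M; rewrite trmx1 mulmx1; split=> //.
  apply/rowP => j; rewrite !mxE eqxx eq_sym /=.
  by congr (_ == _)%:R; apply: val_inj.
pose v := e0 - e.
have v2_neq0 : dot v v != 0.
  by apply: contra_neq e_neq => /dotxx_eq0 /eqP; rewrite subr_eq0 => /eqP.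
pose c := 2 / dot v v.
pose P : 'M[R]_(1 + n) := v^T *m v.
have PT : P^T = P by rewrite /P trmx_mul trmxK.
have PP : P *m P = dot v v *: P.
  rewrite /P mulmxA -(mulmxA v^T) [v *m v^T]mx11_scalar -/(dot v v).
  by rewrite mul_mx_scalar -scalemxAl.
pose H := 1%:M - c *: P.
have HT : H^T = H by rewrite /H linearB /= linearZ /= trmx1 PT.
have HH : H *m H = 1%:M.
  rewrite /H mulmxBl mul1mx mulmxBr mulmx1.
  rewrite -scalemxAl -scalemxAr PP !scalerA.
  have -> : c * c * dot v v = c + c by rewrite /c; field.
  by rewrite scalerDl opprB addrK subrK.
exists H; rewrite HT; split=> //.
(* Both vectors have length 1, so [|e0 - e| ^ 2 = 2 (1 - e0 . e) = 2 e0 . v]. *)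
have c_v0 : c * dot e0 v = 1.
  have e00 : dot e0 e0 = 1 by rewrite dot_delta mxE !eqxx.
  have vE : v = (- 1) *: e + e0 by rewrite /v scaleN1r addrC.
  have v2 : dot v v = 2 * dot e0 v.
    by rewrite {1}vE dot_scalar vE !dot_scalarr e1 e00 (dotC e e0); ring.
  by rewrite /c v2; field; apply: contra_neq v2_neq0 => e0v; rewrite v2 e0v mulr0.
have row0E (A : 'M[R]_(1 + n)) : usubmx A = e0 *m A.
  by rewrite -rowE; apply/rowP => j; rewrite !mxE; congr (A _ _); apply/val_inj.
rewrite row0E.
rewrite mulmxBr mulmx1 -scalemxAr mulmxA.
rewrite [e0 *m v^T]mx11_scalar -/(dot e0 v) mul_scalar_mx scalerA c_v0 scale1r.
by rewrite /v opprB addrC subrK.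
Qed.

Section OrthSplit.
Context (R : realType) (n : nat) (e : 'rV[R]_n.+1) (U : 'M[R]_(n, n.+1)).
Hypotheses (e_unit : dot e e = 1) (eU : orth_split e U).

Lemma orth_splitE x : x = dot x e *: e + x *m U^T *m U.
Proof.
case: eU => _ _ eU1; rewrite -{1}[x]mulmx1 -eU1 mulmxDr !mulmxA.
by rewrite {1}[x *m e^T]mx11_scalar mul_scalar_mx.
Qed.

Lemma dot_split y z : dot (y *m U) (z *m U) = dot y z.
Proof.
by case: eU => UU _ _; rewrite /dot trmx_mul mulmxA -(mulmxA y) UU mulmx1.
Qed.

Lemma dot_split_e y : dot (y *m U) e = 0.
Proof. by case: eU => _ Ue _; rewrite /dot -mulmxA Ue mulmx0 mxE. Qed.

Lemma dotxx_split t y :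
  dot (t *: e + y *m U) (t *: e + y *m U) = t ^+ 2 + dot y y.
Proof.
rewrite dot_scalar !dot_scalarr dot_split (dotC e (y *m U)) dot_split_e e_unit.
by ring.
Qed.

Lemma sosfun_split (f : 'rV[R]_n.+1 -> R) :
  sosfun (fun x => f (dot x e *: e + x *m U^T *m U)) -> sosfun f.
Proof. by apply: sosfun_ext => x; rewrite -orth_splitE. Qed.

End OrthSplit.

(** * Quadratic forms *)

(** Completion of the square in one variable, by induction on the dimension. *)
Lemma psd_sosfun (R : realType) (n : nat) (Q : 'rV[R]_n -> 'rV[R]_n -> R) :
    (forall y, scalar (Q^~ y)) -> (forall x y, Q x y = Q y x) ->
    (forall x, 0 <= Q x x) ->
  sosfun (fun x => Q x x).
Proof.
elim: n Q => [|n IHn] Q Q_lin Q_sym Q_ge0.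
  apply: sosfun_ext (sosfun0 _ _) => x.
  by rewrite [x]thinmx0 (scalar_fun0 (Q_lin _)).
have Q_linr x : scalar (Q x) by move=> a u v; rewrite ![Q x _]Q_sym Q_lin.
pose e : 'rV[R]_n.+1 := delta_mx 0 0.
have e_unit : dot e e = 1 by rewrite dot_delta mxE !eqxx.
have [U eU] := orth_split_exists e_unit.
have QE t y : Q (t *: e + y) (t *: e + y) = t ^+ 2 * Q e e + 2 * t * Q e y + Q y y.
  by rewrite Q_lin !Q_linr (Q_sym y e); ring.
apply: (@sosfun_split _ _ e U eU (fun x => Q x x)).
have Qey_lin : scalar (fun y => Q e (y *m U)).
  by move=> a u v; rewrite mulmxDl -scalemxAl Q_linr.
have [a0|a_neq0] := eqVneq (Q e e) 0.
  have Qe0 y : Q e y = 0.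
    apply/eqP; apply: contraT => b_neq0.
    (* If [Q e y] were nonzero, the form would take the value -1 at this point. *)
    have := Q_ge0 ((- (Q y y + 1) / (2 * Q e y)) *: e + y); rewrite QE a0.
    have -> : 2 * (- (Q y y + 1) / (2 * Q e y)) * Q e y = - (Q y y + 1) by field.
    lra.
  have := IHn (fun y z => Q (y *m U) (z *m U)).
  move=> /(_ _ _ _)/(sosfun_mulmx U^T) Q_sos.
  apply: sosfun_ext (Q_sos _ _ _) => //.
  - by move=> x; rewrite QE a0 Qe0; ring.
  - by move=> y a u v; rewrite mulmxDl -scalemxAl Q_lin.
have a_gt0 : 0 < Q e e by rewrite lt_def a_neq0 Q_ge0.
(* The Schur complement: [S y y] is the minimum over [t] of the form at [t e + y U], hence
   nonnegative. *)
pose S y z := Q (y *m U) (z *m U) - Q e (y *m U) * Q e (z *m U) / Q e e.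
have S_sos : sosfun (fun y => S y y).
  apply: IHn => [y a u v|x y|x]; rewrite /S.
  - by rewrite !mulmxDl -!scalemxAl Q_lin Q_linr; field.
  - by rewrite (Q_sym (x *m U)) (mulrC (Q e _)).
  - have := Q_ge0 ((- Q e (x *m U) / Q e e) *: e + x *m U); rewrite QE.
    congr (0 <= _); by field.
have sqr_sos : sosfun (fun x => Q e e *
    (dot x e + (Q e e)^-1 * Q e (x *m U^T *m U)) ^+ 2).
  apply: sosfun_sqr (ltW a_gt0) _; apply: polyfunD; first exact: polyfun_dot.
  apply: polyfunM; first exact: polyfun_cst.
  apply: (@polyfun_scalar _ _ (fun x _ => Q e (x *m U^T *m U))) => [_|i].
    by move=> a u v; rewrite mulmxDl -scalemxAl Qey_lin.
  exact: polyfun_cst.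
apply: sosfun_ext (sosfunD sqr_sos (sosfun_mulmx U^T S_sos)) => x.
by rewrite QE /S; field.
Qed.

(** * Quartic forms as diagonals of quadrilinear forms *)

Definition quadrilinear (R : realType) (n : nat)
    (T : 'rV[R]_n -> 'rV[R]_n -> 'rV[R]_n -> 'rV[R]_n -> R) : Prop :=
  [/\ forall y z w, scalar (fun x => T x y z w),
      forall x z w, scalar (fun y => T x y z w),
      forall x y w, scalar (fun z => T x y z w)
    & forall x y z, scalar (fun w => T x y z w)].

Definition symmetric4 (R : realType) (n : nat)
    (T : 'rV[R]_n -> 'rV[R]_n -> 'rV[R]_n -> 'rV[R]_n -> R) : Prop :=
  [/\ forall x y z w, T x y z w = T y x z w,
      forall x y z w, T x y z w = T x z y w
    & forall x y z w, T x y z w = T x y w z].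

(** In this encoding the value at [t e + y] expands by linearity alone. [T] need not be symmetric,
    which keeps the closure properties immediate. *)
Definition quartic (R : realType) (n : nat) (f : 'rV[R]_n -> R) : Prop :=
  exists2 T, quadrilinear T & forall x, f x = T x x x x.

Section Quartic.
Context (R : realType).
Implicit Types n : nat.

Lemma quartic_ext n (f g : 'rV[R]_n -> R) : f =1 g -> quartic f -> quartic g.
Proof. by move=> fg [T T_lin fT]; exists T => // x; rewrite -fg. Qed.

Lemma quartic0 n : quartic (fun _ : 'rV[R]_n => 0).
Proof.
by exists (fun _ _ _ _ => 0) => //; split=> ? ? ? a u v; rewrite mulr0 addr0.
Qed.

Lemma quarticD n (f g : 'rV[R]_n -> R) :
  quartic f -> quartic g -> quartic (fun x => f x + g x).
Proof.
move=> [T [T1 T2 T3 T4] fT] [S [S1 S2 S3 S4] gS].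
exists (fun x y z w => T x y z w + S x y z w) => [|x]; last by rewrite fT gS.
split=> ? ? ? a u v /=.
- by rewrite T1 S1; ring.
- by rewrite T2 S2; ring.
- by rewrite T3 S3; ring.
- by rewrite T4 S4; ring.
Qed.

Lemma quarticZ n c (f : 'rV[R]_n -> R) : quartic f -> quartic (fun x => c * f x).
Proof.
move=> [T [T1 T2 T3 T4] fT].
exists (fun x y z w => c * T x y z w) => [|x]; last by rewrite fT.
split=> ? ? ? a u v /=.
- by rewrite T1; ring.
- by rewrite T2; ring.
- by rewrite T3; ring.
- by rewrite T4; ring.
Qed.

Lemma quartic_sum n (I : Type) (r : seq I) (f : I -> 'rV[R]_n -> R) :
  (forall i, quartic (f i)) -> quartic (fun x => \sum_(i <- r) f i x).
Proof.
move=> f_quartic; elim: r => [|i r IHr].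
  by apply: quartic_ext (quartic0 n) => x; rewrite big_nil.
by apply: quartic_ext (quarticD (f_quartic i) IHr) => x; rewrite big_cons.
Qed.

Lemma quartic_sqr n (Q : 'rV[R]_n -> 'rV[R]_n -> R) :
    (forall y, scalar (Q^~ y)) -> (forall x, scalar (Q x)) ->
  quartic (fun x => Q x x ^+ 2).
Proof.
move=> Q1 Q2; exists (fun x y z w => Q x y * Q z w); last by move=> x.
split=> ? ? ? a u v /=.
- by rewrite Q1; ring.
- by rewrite Q2; ring.
- by rewrite Q1; ring.
- by rewrite Q2; ring.
Qed.

Lemma quartic_mulmx n m (U : 'M[R]_(n, m)) (f : 'rV[R]_m -> R) :
  quartic f -> quartic (fun x => f (x *m U)).
Proof.
move=> [T [T1 T2 T3 T4] fT].
exists (fun x y z w => T (x *m U) (y *m U) (z *m U) (w *m U)) => //.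
by split=> ? ? ? a u v /=; rewrite mulmxDl -scalemxAl (T1, T2, T3, T4).
Qed.

Lemma quartic_polyfun n (f : 'rV[R]_n -> R) : quartic f -> polyfun f.
Proof.
move=> [T [T1 T2 T3 T4] fT]; apply: (@polyfun_ext _ _ (fun x => T x x x x)) => //.
apply: (@polyfun_scalar _ _ (fun x y => T x y y y)) => // i.
apply: (@polyfun_scalar _ _ (fun x y => T (delta_mx 0 i) x y y)) => // j.
apply: (@polyfun_scalar _ _
  (fun x y => T (delta_mx 0 i) (delta_mx 0 j) x y)) => // k.
apply: (@polyfun_scalar _ _
  (fun x _ => T (delta_mx 0 i) (delta_mx 0 j) (delta_mx 0 k) x)) => // l.
exact: polyfun_cst.
Qed.

Lemma quarticZZ n (f : 'rV[R]_n -> R) c x : quartic f -> f (c *: x) = c ^+ 4 * f x.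
Proof.
move=> [T [T1 T2 T3 T4] fT]; rewrite !fT.
rewrite (scalar_funZ (T1 _ _ _)) (scalar_funZ (T2 _ _ _)) (scalar_funZ (T3 _ _ _)).
by rewrite (scalar_funZ (T4 _ _ _)); ring.
Qed.

(** [T] is averaged over the 24 orders of its arguments; [S1] runs through the orders with a given
    first one. Linearity is computed in the first slot and carried to the others by symmetry. *)
Lemma quartic_symmetrize n (f : 'rV[R]_n -> R) : quartic f ->
  exists T, [/\ quadrilinear T, symmetric4 T & forall x, f x = T x x x x].
Proof.
move=> [T [T1 T2 T3 T4] fT].
pose S1 x y z w :=
  T x y z w + T x y w z + T x z y w + T x z w y + T x w y z + T x w z y.
pose S x y z w := (S1 x y z w + S1 y x z w + S1 z x y w + S1 w x y z) / 24.
have S_sym : symmetric4 S by split=> x y z w; rewrite /S /S1; ring.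
have S_lin y z w : scalar (fun x => S x y z w).
  by move=> a u v; rewrite /S /S1 !T1 !T2 !T3 !T4; field.
exists S; split=> //; last by move=> x; rewrite fT /S /S1; field.
have [S12 S23 S34] := S_sym.
have S_lin2 x z w : scalar (fun y => S x y z w).
  by move=> a u v; rewrite S12 S_lin !(S12 _ x).
have S_lin3 x y w : scalar (fun z => S x y z w).
  by move=> a u v; rewrite S23 S_lin2 !(S23 _ _ y).
by split=> // x y z a u v; rewrite S34 S_lin3 !(S34 _ _ _ z).
Qed.

End Quartic.

(** * Bernstein's inequality for cubic forms in any dimension *)

Definition symmetric_trilinear (R : realType) (n : nat)
    (S : 'rV[R]_n -> 'rV[R]_n -> 'rV[R]_n -> R) : Prop :=
  [/\ forall y z, scalar (fun x => S x y z),
      forall x y z, S x y z = S y x z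
    & forall x y z, S x y z = S x z y].

(** The sum is [|G| ^ 2], where [G] is a third of the gradient of the cubic form at [y]. The radial
    component of [G] is [S y y y]; if the rest is nonzero, with direction [u], then
    [|G| ^ 2 = (S y y y) ^ 2 + (S y y u) ^ 2], which [bernstein_cubic] bounds in the plane of [y]
    and [u]. *)
Lemma bernstein_gradient (R : realType) (n : nat)
    (S : 'rV[R]_n -> 'rV[R]_n -> 'rV[R]_n -> R) (beta : R) :
    symmetric_trilinear S ->
    (forall y, dot y y = 1 -> `|S y y y| <= beta) ->
  forall y, dot y y = 1 -> \sum_i S y y (delta_mx 0 i) ^+ 2 <= beta ^+ 2.
Proof.
move=> [S1 S12 S23] S_le y y_unit.
have S2 x z : scalar (fun y => S x y z) by move=> a u v; rewrite S12 S1 !(S12 _ x).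
have S3 x z : scalar (fun y => S x z y) by move=> a u v; rewrite S23 S2 !(S23 _ _ z).
pose G : 'rV[R]_n := \row_i S y y (delta_mx 0 i).
have GE w : dot G w = S y y w.
  rewrite dotE (scalar_fun_sum_delta (S3 y y)); apply: eq_bigr => i _.
  by rewrite mxE mulrC.
have -> : \sum_i S y y (delta_mx 0 i) ^+ 2 = dot G G.
  by rewrite dotxxE; apply: eq_bigr => i _; rewrite mxE.
pose a := S y y y.
pose G' := (- a) *: y + G.
have G'y : dot G' y = 0 by rewrite dot_scalar GE y_unit -/a; ring.
have GG' : G = a *: y + G' by rewrite /G' scaleNr addNKr.
clearbody G'.
have GG : dot G G = a ^+ 2 + dot G' G'.
  by rewrite GG' dot_scalar !dot_scalarr y_unit (dotC y) G'y; ring.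
have [G'0|G'_neq0] := eqVneq G' 0.
  rewrite GG G'0 (scalar_fun0 (dot_scalar _)) addr0 -real_normK ?num_real //.
  by rewrite ler_pXn2r ?nnegrE ?normr_ge0 ?S_le // (le_trans _ (S_le y y_unit)).
have [u u_unit G'E] := scale_unit G'_neq0.
set r := Num.sqrt _ in G'E.
have r_neq0 : r != 0.
  by apply: contra_neq G'_neq0 => r0; rewrite G'E r0 scale0r.
have uy : dot u y = 0.
  apply: (mulfI r_neq0); rewrite mulr0 -(scalar_funZ (dot_scalar y)).
  by rewrite -G'E G'y.
have bE : S y y u = r.
  rewrite -GE GG' G'E dot_scalar (dotC y) uy (scalar_funZ (dot_scalar u)) u_unit.
  by ring.
have -> : dot G G = a ^+ 2 + (S y y u) ^+ 2.
  by rewrite GG bE sqr_sqrtr ?dotxx_ge0.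
apply: (@bernstein_cubic _ _ _ (S y u u) (S u u u)) => s t st1.
have := S_le (s *: y + t *: u).
have -> : dot (s *: y + t *: u) (s *: y + t *: u) = 1.
  rewrite dot_scalar !dot_scalarr !(scalar_funZ (dot_scalar _)).
  by rewrite !(scalar_funZ (dot_scalarr _)) (dotC y u) uy y_unit u_unit; lra.
move=> /(_ erefl); congr (`| _ | <= _).
rewrite S1 !S2 !S3 !(scalar_funZ (S1 _ _)) !(scalar_funZ (S2 _ _)).
rewrite !(scalar_funZ (S3 _ _)) (S23 y u y) (S12 u y y) (S23 y u y).
rewrite (S12 u y u) (S23 u u y) (S12 u y u).
by rewrite /a; ring.
Qed.

(** * Quartic forms around a minimizer *)

Lemma quartic_ge (R : realType) (n : nat) (f : 'rV[R]_n -> R) (m : R) :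
  quartic f -> (forall x, dot x x = 1 -> m <= f x) ->
  forall x, m * dot x x ^+ 2 <= f x.
Proof.
move=> f_quartic f_ge x; have [->|x_neq0] := eqVneq x 0.
  have -> : 0 = 0 *: (0 : 'rV[R]_n) by rewrite scale0r.
  by rewrite (quarticZZ _ _ f_quartic) dotZZ !expr0n /= !mul0r expr0n /= mulr0.
have [u u_unit ->] := scale_unit x_neq0.
rewrite (quarticZZ _ _ f_quartic) dotZZ u_unit mulr1 -exprM mulrC.
by rewrite ler_wpM2l ?f_ge // exprn_ge0 // sqrtr_ge0.
Qed.

Lemma quartic_minimizer (R : realType) (n : nat) (f : 'rV[R]_n.+1 -> R) :
  quartic f -> exists2 e, dot e e = 1 & forall x, dot x x = 1 -> f e <= f x.
Proof.
move=> /quartic_polyfun[P fP].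
have [x|e e_unit e_min] := @SphereMin.polynomial_min_on_sphere R n _
  (msupp P) (fun m => P@_m) (fun m i => m i) f.
  by rewrite fP mevalE.
by exists e => [|x]; rewrite dotxxE //; exact: e_min.
Qed.

(** Let [T] be the symmetric form of [f] and [y] orthogonal to [e]. As a polynomial in [t],
    [f (t e + y) - f e (t ^ 2 + |y| ^ 2) ^ 2] is nonnegative and its terms in [t ^ 4] cancel. So the
    coefficient [4 T e e e y] of [t ^ 3] vanishes, and that of [t ^ 2] is nonnegative, which is the
    bound on [A]. *)
Lemma quartic_min_expansion (R : realType) (n : nat) (f : 'rV[R]_n.+1 -> R) :
  quartic f -> exists e U A S C,
  [/\ dot e e = 1, orth_split e U & forall x, f e * dot x x ^+ 2 <= f x] /\
  [/\ [/\ forall y, scalar (fun x => A x y), forall x y, A x y = A y x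
        & forall y, 2 * f e * dot y y <= A y y],
      symmetric_trilinear S, quartic C
    & forall t y, f (t *: e + y *m U) =
        f e * t ^+ 4 + t ^+ 2 * A y y + t * S y y y + C y].
Proof.
move=> f_quartic.
have [e e_unit e_min] := quartic_minimizer f_quartic.
have f_ge := quartic_ge f_quartic e_min.
have [U eU] := orth_split_exists e_unit.
have [T [[T1 T2 T3 T4] [T12 T23 T34] fT]] := quartic_symmetrize f_quartic.
exists e, U, (fun y z => 6 * T e e (y *m U) (z *m U)),
  (fun x y z => 4 * T e (x *m U) (y *m U) (z *m U)), (fun y => f (y *m U)).
have fE t y : f (t *: e + y) = f e * t ^+ 4 + 4 * t ^+ 3 * T e e e y +
    6 * t ^+ 2 * T e e y y + 4 * t * T e y y y + f y.
  rewrite !fT T1 !T2 !T3 !T4.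
  by rewrite !(T12 y e, T23 _ y e, T34 _ _ y e); ring.
have [T3_0 A_ge] : (forall y : 'rV_n, T e e e (y *m U) = 0) /\
    (forall y : 'rV_n, 2 * f e * dot y y <= 6 * T e e (y *m U) (y *m U)).
  split=> y;
  have [] := @cubic_nonneg_coefs R (4 * T e e e (y *m U))
    (6 * T e e (y *m U) (y *m U) - 2 * f e * dot y y)
    (4 * T e (y *m U) (y *m U) (y *m U)) (f (y *m U) - f e * dot y y ^+ 2).
  - move=> t; have := f_ge (t *: e + y *m U).
    rewrite fE (dotxx_split e_unit eU) -subr_ge0; congr (0 <= _); ring.
  - by move=> ? _; lra.
  - move=> t; have := f_ge (t *: e + y *m U).
    rewrite fE (dotxx_split e_unit eU) -subr_ge0; congr (0 <= _); ring.
  - by move=> _; lra.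
split=> //; split.
- split=> [y a u v|y z|//].
    by rewrite mulmxDl -scalemxAl T3; ring.
  by rewrite T34.
- split=> [y z a u v|x y z|x y z]; last 2 first.
  + by rewrite T23.
  + by rewrite T34.
  by rewrite mulmxDl -scalemxAl T2; ring.
- exact: quartic_mulmx.
- by move=> t y; rewrite fE T3_0; ring.
Qed.

(** * Induction on the number of variables *)

(** [m] and [M] are any bounds, attained or not, so that estimates of the range suffice. For [k = 0]
    the property says that nonnegative quartic forms are sums of squares. *)
Definition sos_ratio (R : realType) (n : nat) (k : R) : Prop :=
  forall (f : 'rV[R]_n -> R) (m M : R), quartic f ->
    (forall x, dot x x = 1 -> m <= f x <= M) ->
    0 <= m -> k * (M - m) <= m -> sosfun f.

Lemma quartic_le (R : realType) (n : nat) (f : 'rV[R]_n -> R) (M : R) :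
  quartic f -> (forall x, dot x x = 1 -> f x <= M) ->
  forall x, f x <= M * dot x x ^+ 2.
Proof.
move=> f_quartic f_le x.
have := @quartic_ge R n (fun x => - 1 * f x) (- M) (quarticZ _ f_quartic) _ x.
rewrite mulN1r mulNr lerN2; apply=> y y_unit.
by rewrite mulN1r lerN2 f_le.
Qed.

(** The complement of [e] is a line, so every term left after subtracting [mu |x| ^ 4] contains the
    square of the coordinate on that line; the cofactor [Q] is a nonnegative quadratic form. *)
Lemma sos_ratio2 (R : realType) : sos_ratio 2 (0 : R).
Proof.
move=> f m M f_quartic f_mM m_ge0 _.
have [e [U [A [S [C [[e_unit eU f_ge] [[A1 A12 A_ge] [S1 S12 S23] C_quartic fE]]]]]]] :=
  quartic_min_expansion f_quartic.
set mu := f e in f_ge A_ge fE.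
have mu_ge0 : 0 <= mu by have /andP[/(le_trans m_ge0)] := f_mM _ e_unit.
pose v : 'rV[R]_1 := delta_mx 0 0.
have v_unit : dot v v = 1 by rewrite dot_delta mxE !eqxx.
have vE (y : 'rV[R]_1) : y = y 0 0 *: v.
  by apply/rowP => i; rewrite (ord1 i) !mxE !eqxx mulr1.
pose a := A v v - 2 * mu; pose s := S v v v; pose c := C v - mu.
have a_ge0 : 0 <= a by have := A_ge v; rewrite v_unit /a; lra.
have q_ge0 t : 0 <= a * t ^+ 2 + s * t + c.
  have := f_ge (t *: e + v *m U); rewrite fE (dotxx_split e_unit eU) v_unit.
  by rewrite -subr_ge0; congr (0 <= _); rewrite /a /s /c; ring.
pose w := v *m U.
have A2 x : scalar (A x) by move=> b y z; rewrite ![A x _]A12 A1.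
have S2 x z : scalar (fun y => S x y z) by move=> b y y'; rewrite S12 S1 !(S12 _ x).
have S3 x z : scalar (S x z) by move=> b y y'; rewrite S23 S2 !(S23 _ _ z).
pose Q x z := a * (dot x e * dot z e) +
  s / 2 * (dot x e * dot z w + dot z e * dot x w) + c * (dot x w * dot z w).
have Q_sos : sosfun (fun x => Q x x).
  apply: psd_sosfun => [z b x y|x z|x]; rewrite /Q.
  - by rewrite !dot_scalar; field.
  - by ring.
  (* Where [dot x w = 0], only the term in [a] is left; elsewhere the form is [(dot x w) ^ 2] times
     the polynomial of [q_ge0] at a quotient. *)
  - have [w0|w_neq0] := eqVneq (dot x w) 0.
      by rewrite w0 !(mulr0, addr0) -expr2 mulr_ge0 ?sqr_ge0.
    have := mulr_ge0 (sqr_ge0 (dot x w)) (q_ge0 (dot x e / dot x w)).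
    by congr (0 <= _); field.
have sqr_sos : sosfun (fun x : 'rV[R]_2 => mu * dot x x ^+ 2).
  by apply: sosfun_sqr mu_ge0 _; exact: polyfun_dotxx.
have w_poly : polyfun (fun x : 'rV[R]_2 => dot x w) by exact: polyfun_dot.
apply: sosfun_ext (sosfunD sqr_sos (sosfun_sqrM w_poly Q_sos)) => x.
rewrite (orth_splitE eU x); set t := dot x e; set y := x *m U^T.
rewrite (dotxx_split e_unit eU) fE /Q !dot_scalar e_unit !(dot_split_e eU).
rewrite (dotC e w) (dot_split_e eU) (dot_split eU) (vE y).
have -> : C (y 0 0 *: v) = y 0 0 ^+ 4 * C v by exact: quarticZZ.
rewrite (scalar_funZ (A1 _)) (scalar_funZ (A2 _)) (scalar_funZ (S1 _ _)).
rewrite (scalar_funZ (S2 _ _)) (scalar_funZ (S3 _ _)).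
rewrite dotZZ (scalar_funZ (dot_scalar _)) v_unit /a /s /c.
by field.
Qed.

(** In [sos_ratio_step], the right side is the lower bound of [h] and the left side [k] times the
    width of its range. After multiplication by [9 mu], right minus left is [(mu - k' D) (8 mu + D
    (8 k' - 9 k)) + D ^ 2 (8 k' ^ 2 - 2 - k (9 k' + 2))]. *)
Lemma ratio_bound (R : realFieldType) (k k' mu D : R) :
    0 <= k -> 0 < k' -> k * (9 * k' + 2) <= 8 * k' ^+ 2 - 2 ->
    0 < mu -> 0 <= D -> k' * D <= mu ->
  k * (D + 2 / 9 * (D ^+ 2 / mu)) <= 8 / 9 * mu - 2 / 9 * (D ^+ 2 / mu).
Proof.
move=> k_ge0 k'_gt0 kk' mu_gt0 D_ge0 D_le.
rewrite -(@ler_pM2l _ (9 * mu)) ?mulr_gt0 ?ltr0n //.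
have mu_neq0 : mu != 0 by rewrite gt_eqF.
have -> : 9 * mu * (k * (D + 2 / 9 * (D ^+ 2 / mu))) =
  k * (9 * D * mu + 2 * D ^+ 2) by field.
have -> : 9 * mu * (8 / 9 * mu - 2 / 9 * (D ^+ 2 / mu)) =
  8 * mu ^+ 2 - 2 * D ^+ 2 by field.
have k9 : 9 * k <= 8 * k'.
  rewrite -(ler_pM2r k'_gt0); have -> : 8 * k' * k' = 8 * k' ^+ 2 by ring.
  by lra.
have D_k9 : 0 <= D * (8 * k' - 9 * k) by rewrite mulr_ge0 ?subr_ge0.
have slack : 0 <= 8 * k' ^+ 2 - 2 - k * (9 * k' + 2) by rewrite subr_ge0.
have mu_slack : 0 <= mu - k' * D by rewrite subr_ge0.
have mu8 : 0 <= 8 * mu + D * (8 * k' - 9 * k) by rewrite addr_ge0 // mulr_ge0 ?ltW.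
have := mulr_ge0 (sqr_ge0 D) slack; have := mulr_ge0 mu_slack mu8.
by lra.
Qed.

Lemma sos_ratio_step (R : realType) (n : nat) (k k' : R) :
    0 <= k -> 0 < k' -> k * (9 * k' + 2) <= 8 * k' ^+ 2 - 2 ->
  sos_ratio n k -> sos_ratio n.+1 k'.
Proof.
move=> k_ge0 k'_gt0 kk' IHn f m M f_quartic f_mM m_ge0 mM.
have [e [U [A [S [C [[e_unit eU f_ge] [[A1 A12 A_ge] S_tri C_quartic fE]]]]]]] :=
  quartic_min_expansion f_quartic.
set mu := f e in f_ge A_ge fE.
have /andP[m_le_mu mu_le_M] := f_mM _ e_unit; rewrite -/mu in m_le_mu mu_le_M.
have f_le : forall x, f x <= M * dot x x ^+ 2.
  by apply: quartic_le => // x /f_mM /andP[].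
pose D := M - mu.
have D_ge0 : 0 <= D by rewrite subr_ge0.
have D_le : k' * D <= mu.
  apply: (le_trans _ m_le_mu); apply: (le_trans _ mM).
  by rewrite ler_pM2l // lerD2l lerN2.
(* If [mu = 0], then [D = 0] and [f] vanishes everywhere. *)
have [mu0|mu_neq0] := eqVneq mu 0.
  apply: sosfun_ext (sosfun0 _ _) => x; apply/le_anti/andP; split.
    by have := f_ge x; rewrite mu0 mul0r.
  have M0 : M = 0.
    apply/eqP; rewrite eq_le -{2}mu0 mu_le_M andbT.
    by move: D_le; rewrite /D mu0 subr0 pmulr_rle0.
  by have := f_le x; rewrite M0 mul0r.
have mu_gt0 : 0 < mu by rewrite lt_def mu_neq0 (le_trans m_ge0).
have [S1 S12 S23] := S_tri.
have S2 x z : scalar (fun y => S x y z) by move=> b y y'; rewrite S12 S1 !(S12 _ x).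
have S3 x z : scalar (S x z) by move=> b y y'; rewrite S23 S2 !(S23 _ _ z).
(* On the circle [t ^ 2 + r ^ 2 = 1] the product [t r ^ 3] is largest at [t = 1 / 2], [r = c]. The
   values of [f] at [t = 1 / 2] and [t = - 1 / 2] differ by [S (c y) (c y) (c y)], which is
   therefore at most [D] in absolute value. *)
pose c : R := Num.sqrt 3 / 2.
have c_gt0 : 0 < c by rewrite divr_gt0 ?sqrtr_gt0 ?ltr0n.
have c2 : c ^+ 2 = 3 / 4.
  by rewrite /c expr_div_n sqr_sqrtr ?ler0n //; field.
have S_le y : dot y y = 1 -> `|S y y y| <= 16 / 9 * c * D.
  move=> y_unit.
  have f_bounds t : t ^+ 2 = 1 / 4 -> mu <= f (t *: e + (c *: y) *m U) <= mu + D.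
    move=> t2.
    have unit : dot (t *: e + (c *: y) *m U) (t *: e + (c *: y) *m U) = 1.
      by rewrite (dotxx_split e_unit eU) dotZZ c2 t2 y_unit; field.
    have := f_ge (t *: e + (c *: y) *m U); have := f_le (t *: e + (c *: y) *m U).
    have -> : mu + D = M by rewrite /D; ring.
    by rewrite unit expr1n !mulr1 => -> ->.
  have /f_bounds/andP[fp fp'] : (1 / 2 : R) ^+ 2 = 1 / 4 by field.
  have /f_bounds/andP[fm fm'] : (- (1 / 2) : R) ^+ 2 = 1 / 4 by field.
  have cS : `|3 / 4 * c * S y y y| <= D.
    have SE : S (c *: y) (c *: y) (c *: y) = 3 / 4 * c * S y y y.
      rewrite (scalar_funZ (S1 _ _)) (scalar_funZ (S2 _ _)) (scalar_funZ (S3 _ _)).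
      by rewrite -c2; ring.
    have := fE (1 / 2) (c *: y); have := fE (- (1 / 2)) (c *: y); rewrite SE.
    by rewrite ler_norml; lra.
  have -> : S y y y = 16 / 9 * c * (3 / 4 * c * S y y y).
    have -> : 16 / 9 * c * (3 / 4 * c * S y y y) = 4 / 3 * c ^+ 2 * S y y y by field.
    by rewrite c2; field.
  have c'_gt0 : 0 < 16 / 9 * c by lra.
  by rewrite normrM gtr0_norm // ler_pM2l.
have sum_b_le := bernstein_gradient S_tri S_le.
have beta2 : (16 / 9 * c * D) ^+ 2 = 64 / 27 * D ^+ 2.
  have -> : (16 / 9 * c * D) ^+ 2 = 256 / 81 * c ^+ 2 * D ^+ 2 by field.
  by rewrite c2; field.
pose b i y := S y y (delta_mx 0 i).
(* What the squares leave. With [t ^ 2 - s r ^ 2] as the first square, the lower bound of [h] would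
   be [mu (1 - s ^ 2) - 8 D ^ 2 / (27 mu (1 + s))]. For [mu = D / 2] and [s > -1] it is nonnegative
   only at [s = 1 / 3], where [(1 - s) (1 + s) ^ 2] has its maximum [32 / 27]. *)
pose h y := C y + - (mu / 9) * dot y y ^+ 2 + - (3 / (32 * mu)) * \sum_i b i y ^+ 2.
have h_quartic : quartic h.
  apply: quarticD; first apply: quarticD => //.
    apply: quarticZ; apply: quartic_sqr => ?; [exact: dot_scalar|exact: dot_scalarr].
  apply: quarticZ; apply: quartic_sum => i.
  exact: (@quartic_sqr _ _ (fun x y => S x y (delta_mx 0 i))).
have h_sos : sosfun h.
  apply: (IHn h (8 / 9 * mu - 2 / 9 * (D ^+ 2 / mu)) (D + 8 / 9 * mu)) => //.
  - move=> y y_unit.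
    have : mu <= C y <= M.
      have CE : C y = f (y *m U) by have := fE 0 y; rewrite scale0r add0r => ->; ring.
      rewrite CE; have := f_ge (y *m U); have := f_le (y *m U).
      by rewrite (dot_split eU) y_unit expr1n !mulr1 => -> ->.
    move=> /andP[C_ge C_le]; rewrite /h y_unit expr1n mulr1.
    have sum_ge0 : 0 <= \sum_i b i y ^+ 2 by apply: sumr_ge0 => i _; exact: sqr_ge0.
    have := sum_b_le y y_unit; rewrite beta2 -/(b _ _).
    set B := \sum_i _ in sum_ge0 *; move=> B_le.
    have k3 : 0 <= 3 / (32 * mu) by rewrite divr_ge0 ?mulr_ge0 ?ler0n ?ltW.
    have := ler_wpM2l k3 B_le; have := mulr_ge0 k3 sum_ge0.
    have -> : 3 / (32 * mu) * (64 / 27 * D ^+ 2) = 2 / 9 * (D ^+ 2 / mu) by field.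
    by rewrite /D; lra.
  - apply: le_trans (ratio_bound k_ge0 k'_gt0 kk' mu_gt0 D_ge0 D_le).
    by rewrite mulr_ge0 // addr_ge0 // mulr_ge0 ?divr_ge0 ?sqr_ge0 ?ltW ?ler0n.
  - apply: le_trans (ratio_bound k_ge0 k'_gt0 kk' mu_gt0 D_ge0 D_le).
    by rewrite ler_wpM2l //; lra.
have A_sos : sosfun (fun y => A y y - 2 * mu * dot y y).
  apply: (@psd_sosfun _ _ (fun y z => A y z - 2 * mu * dot y z)) => [z r x y|x y|y].
  - by rewrite A1 dot_scalar; ring.
  - by rewrite A12 dotC.
  - by rewrite subr_ge0.
have t_poly : polyfun (fun x => dot x e) by exact: polyfun_dot.
have r_poly : polyfun (fun x => dot (x *m U^T) (x *m U^T)).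
  exact: polyfun_mulmx (@polyfun_dotxx R n).
have b_poly i : polyfun (fun x => b i (x *m U^T)).
  apply: (@polyfun_mulmx _ _ _ _ (b i)).
  apply: (@polyfun_scalar _ _ (fun x y => S x y (delta_mx 0 i))) => // j.
  apply: (@polyfun_scalar _ _
    (fun x _ => S (delta_mx 0 j) x (delta_mx 0 i))) => // l.
  exact: polyfun_cst.
have sos1 : sosfun (fun x => mu *
    (dot x e * dot x e + - (1 / 3) * dot (x *m U^T) (x *m U^T)) ^+ 2).
  apply: sosfun_sqr (ltW mu_gt0) _; apply: polyfunD; first exact: polyfunM.
  by apply: polyfunM => //; exact: polyfun_cst.
have sos2 := sosfun_sqrM t_poly (sosfun_mulmx U^T A_sos).
have sos3 : sosfun (fun x => \sum_i 8 / 3 * mu *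
    (dot x e * (x *m U^T) 0 i + 3 / (16 * mu) * b i (x *m U^T)) ^+ 2).
  apply: sosfun_sum => i; apply: sosfun_sqr.
    by lra.
  apply: polyfunD; apply: polyfunM => //; last exact: polyfun_cst.
  exact: (polyfun_mulmx U^T (polyfun_coord _ i)).
have sos4 := sosfun_mulmx U^T h_sos.
apply: sosfun_ext (sosfunD (sosfunD sos1 sos2) (sosfunD sos3 sos4)) => x.
rewrite [in RHS](orth_splitE eU x) fE.
set t := dot x e; set y := x *m U^T.
(* [S y y y] is the sum of the [y_i b_i]. In the whole expression the multiples [- 2 / 3], [- 2] and
   [8 / 3] of [mu t ^ 2 r ^ 2] cancel. *)
have -> : \sum_i 8 / 3 * mu * (t * y 0 i + 3 / (16 * mu) * b i y) ^+ 2 =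
    8 / 3 * mu * t ^+ 2 * dot y y + t * S y y y + 3 / (32 * mu) * \sum_i b i y ^+ 2.
  rewrite dotxxE (scalar_fun_sum_delta (S3 y y) y) !mulr_sumr -!big_split /=.
  by apply: eq_bigr => i _; rewrite /b; field.
by rewrite /h; field.
Qed.

(** * Polynomials and their values *)

(** Uniqueness of digits in base [N]: the remainder modulo [N] gives the lowest one. *)
Lemma base_expansion_inj (n N : nat) (f g : 'I_n -> nat) :
    (forall i, (f i < N)%N) -> (forall i, (g i < N)%N) ->
    (\sum_(i < n) f i * N ^ i = \sum_(i < n) g i * N ^ i)%N ->
  f =1 g.
Proof.
elim: n f g => [|n IHn] f g f_lt g_lt; first by move=> _ [].
have sumE (h : 'I_n.+1 -> nat) : (\sum_(i < n.+1) h i * N ^ i =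
    (\sum_(i < n) h (lift ord0 i) * N ^ i) * N + h ord0)%N.
  rewrite big_ord_recl expn0 muln1 addnC big_distrl /=; congr (_ + _)%N.
  by apply: eq_bigr => i _; rewrite expnSr mulnA.
rewrite !sumE => fg.
have fg0 : f ord0 = g ord0.
  by have := congr1 (modn^~ N) fg; rewrite !modnMDl !modn_small.
have fg_lift : forall i, f (lift ord0 i) = g (lift ord0 i).
  apply: IHn => [i|i|]; [exact: f_lt|exact: g_lt|].
  have N_gt0 : (0 < N)%N by case: (N) (f_lt ord0).
  by move: fg; rewrite fg0 => /addIn/eqP; rewrite eqn_pmul2r // => /eqP.
by move=> i; case: (unliftP ord0 i) => [j|] ->.
Qed.

(* Kronecker substitution [x_i := t ^ (N ^ i)], which is injective on the
   monomials of [P] once [N] exceeds all exponents. *)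
Lemma mpoly_eq0_of_meval (R : realFieldType) (n : nat) (P : {mpoly R[n]}) :
  (forall x : 'I_n -> R, P.@[x] = 0) -> P = 0.
Proof.
move=> P0; pose N := msize P.
pose code (m : 'X_{1..n}) := (\sum_(i < n) m i * N ^ i)%N.
pose Q : {poly R} := \sum_(m <- msupp P) P@_m *: 'X^(code m).
have Q0 : Q = 0.
  (* [Q] at [k] is [P] at the point with coordinates [k ^ (N ^ i)], so [Q] vanishes at more integers
     than its size. *)
  apply: (@roots_geq_poly_eq0 R Q [seq i%:R | i <- iota 0 (size Q).+1]).
  - apply/allP => _ /mapP[k _ ->]; apply/eqP.
    rewrite /Q horner_sum -[RHS](P0 (fun i : 'I_n => k%:R ^+ (N ^ i))) mevalE.
    apply: eq_bigr => m _; rewrite !hornerE; congr (_ * _).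
    rewrite /code expr_sum; apply: eq_bigr => i _.
    by rewrite -exprM mulnC.
  - rewrite map_inj_uniq ?iota_uniq // => i j /eqP.
    by rewrite eqr_nat => /eqP.
  - by rewrite size_map size_iota.
apply/mpolyP => m; rewrite mcoeff0.
have [mP|mP] := boolP (m \in msupp P); last exact: memN_msupp_eq0.
have lt_N m' : m' \in msupp P -> forall i, (m' i < N)%N.
  move=> m'P i; apply: leq_ltn_trans (msize_mdeg_lt m'P).
  by rewrite mdegE (bigD1 i) //= leq_addr.
(* No other monomial of [P] has the code of [m], so this coefficient of [Q] is that of [m] in
   [P]. *)
have := congr1 (fun q : {poly R} => q`_(code m)) Q0.
rewrite coef0 /Q coef_sum (bigD1_seq m) //= coefZ coefXn eqxx mulr1.
rewrite big_seq_cond big1 ?addr0 // => m' /andP[m'P m'm].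
rewrite coefZ coefXn; case: eqP => [code_eq|_]; last by rewrite mulr0.
case/negP: m'm; apply/eqP/mnmP => i.
exact/esym/(base_expansion_inj (lt_N _ mP) (lt_N _ m'P) code_eq).
Qed.

Lemma mpolyX_split (R : realType) (n k : nat) (m : 'X_{1..n}) : mdeg m = k.+1 ->
  exists i m', mdeg m' = k /\
    forall x : 'I_n -> R,
      ('X_[m] : {mpoly R[n]}).@[x] = x i * ('X_[m'] : {mpoly R[n]}).@[x].
Proof.
move=> mk.
have [i mi] : exists i, (0 < m i)%N.
  apply/existsP; apply: contraPT mk; rewrite negb_exists => /forallP m0.
  by rewrite mdegE big1 // => i _; apply/eqP; rewrite -leqn0 leqNgt m0.
have U_le : (U_(i) <= m)%MM.
  by apply/mnm_lepP => j; rewrite mnm1E; case: eqP => [<-|].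
have mE := submK U_le.
exists i, (m - U_(i))%MM; split.
  by have := congr1 (@mdeg n) mE; rewrite mdegD mdeg1 addn1 mk => -[].
by move=> x; rewrite -{1}mE mpolyXD mevalM mevalXU mulrC.
Qed.

(** A monomial of degree 4 is a product of four coordinates, one for each slot of a quadrilinear
    form. *)
Lemma dhomog4_quartic (R : realType) (n : nat) (p : {mpoly R[n]}) :
  p \is 4.-homog -> quartic (fun x : 'rV[R]_n => p.@[x 0]).
Proof.
move=> /dhomogP p_homog.
have X_quartic m : mdeg m = 4 ->
    quartic (fun x : 'rV[R]_n => ('X_[m] : {mpoly R[n]}).@[x 0]).
  move=> m_deg; have [i [m1 [m1_deg E1]]] := mpolyX_split R m_deg.
  have [j [m2 [m2_deg E2]]] := mpolyX_split R m1_deg.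
  have [k [m3 [m3_deg E3]]] := mpolyX_split R m2_deg.
  have [l [m4 [m4_deg E4]]] := mpolyX_split R m3_deg.
  have m40 : m4 = 0%MM by apply/eqP; rewrite -mdeg_eq0 m4_deg.
  exists (fun x y z w => x 0 i * (y 0 j * (z 0 k * w 0 l))).
    by split=> ? ? ? a u v; rewrite !mxE; ring.
  by move=> x; rewrite E1 E2 E3 E4 m40 mpolyX0 meval1 mulr1.
(* The test on [m] makes the summand a quartic for every [m], as [quartic_sum] asks. *)
apply: (@quartic_ext _ _ (fun x => \sum_(m <- msupp p)
    (if m \in msupp p then p@_m * ('X_[m] : {mpoly R[n]}).@[x 0] else 0))).
  move=> x; rewrite mevalE big_seq [RHS]big_seq; apply: eq_bigr => m mp.
  by rewrite mp mevalX.
apply: quartic_sum => m.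
have [mp|_] := boolP (m \in msupp p); last exact: quartic0.
by apply/quarticZ/X_quartic; exact: p_homog.
Qed.

Lemma meval_sqnorm_poly (R : realType) (n : nat) (x : 'I_n -> R) :
  (sqnorm_poly R n).@[x] = \sum_i x i ^+ 2.
Proof.
rewrite /sqnorm_poly raddf_sum /=; apply: eq_bigr => i _.
by rewrite rmorphXn /= mevalXU.
Qed.

(** A polynomial over an infinite field is determined by its values. *)
Lemma sosfun_is_sos (R : realType) (n : nat) (p : {mpoly R[n]}) :
  sosfun (fun x : 'rV[R]_n => p.@[x 0]) -> is_sos p.
Proof.
move=> [s ps]; exists s; apply/eqP; rewrite -subr_eq0; apply/eqP.
apply: mpoly_eq0_of_meval => x; apply/eqP; rewrite mevalB subr_eq0; apply/eqP.
have xE : (\row_i x i) 0 =1 x by move=> i; rewrite mxE.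
rewrite -(meval_eq p xE) ps raddf_sum /=.
by apply: eq_bigr => q _; rewrite rmorphXn /= (meval_eq q xE).
Qed.

Lemma unit_sphereP (R : realType) (n : nat) (x : 'I_n -> R) :
  unit_sphere x <-> dot (\row_i x i) (\row_i x i) = 1.
Proof.
have -> : dot (\row_i x i) (\row_i x i) = \sum_i x i ^+ 2.
  by rewrite dotxxE; apply: eq_bigr => i _; rewrite mxE.
have sum_ge0 : 0 <= \sum_i x i ^+ 2 by apply: sumr_ge0 => i _; exact: sqr_ge0.
rewrite /unit_sphere /euclidean_norm /=; split => [x1|->]; last exact: sqrtr1.
by rewrite -(sqr_sqrtr sum_ge0) x1 expr1n.
Qed.

(** * The bound on the gap *)

Theorem corollary2p3 (R : realType) (p : {mpoly R[4]})
    (p_form : p \is 4.-homog)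
    (p_nonconstant : ~ exists c : R, forall x : 'I_4 -> R,
       unit_sphere x -> p.@[x] = c) :
  gap 2 p <= 2.
Proof.
pose f (x : 'rV[R]_4) := p.@[x 0].
have f_quartic : quartic f by exact: dhomog4_quartic.
have [e e_unit e_min] := quartic_minimizer f_quartic.
(* A minimizer of [- f] is a maximizer of [f]. *)
have [e' e'_unit e'_max] := quartic_minimizer (quarticZ (- 1) f_quartic).
have rowE (x : 'I_4 -> R) : p.@[x] = f (\row_i x i).
  by apply: meval_eq => i; rewrite mxE.
have sphere_row (x : 'rV[R]_4) :
    dot x x = 1 -> unit_sphere (x 0).
  move=> x1; apply/unit_sphereP; rewrite (_ : \row_i x 0 i = x) //.
  by apply/rowP => i; rewrite mxE.
set m := f e in e_min; pose M := f e'.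
have f_le x : dot x x = 1 -> f x <= M.
  by move=> x1; have := e'_max x x1; rewrite !mulN1r lerN2.
have minE : sphere_min p = m.
  apply/le_anti/andP; split.
    apply: ge_inf; last by exists (e 0); first exact: sphere_row.
    by exists m => _ [x /unit_sphereP x1 <-]; rewrite rowE e_min.
  apply: lb_le_inf; first by exists m, (e 0) => //; exact: sphere_row.
  by move=> _ [x /unit_sphereP x1 <-]; rewrite rowE e_min.
have maxE : sphere_max p = M.
  apply/le_anti/andP; split.
    apply: ge_sup; first by exists m, (e 0) => //; exact: sphere_row.
    by move=> _ [x /unit_sphereP x1 <-]; rewrite rowE f_le.
  apply: ub_le_sup; last by exists (e' 0); first exact: sphere_row.
  by exists M => _ [x /unit_sphereP x1 <-]; rewrite rowE f_le.
have m_lt_M : m < M.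
  rewrite lt_neqAle f_le // andbT; apply/eqP => mM; apply: p_nonconstant.
  exists m => x /unit_sphereP x1; rewrite rowE; apply/le_anti/andP; split.
    by rewrite mM f_le.
  exact: e_min.
have fE g (x : 'rV[R]_4) :
    (p - g *: sqnorm_poly R 4 ^+ 2).@[x 0] = f x - g * dot x x ^+ 2.
  by rewrite mevalB mevalZ rmorphXn /= meval_sqnorm_poly dotxxE.
(* Evaluation at the minimizer [e] bounds the set that defines [sos_min], so that its [sup] is a
   genuine least upper bound and not a default value. *)
have sos_ub g : is_sos (p - g *: sqnorm_poly R 4 ^+ 2) -> g <= m.
  move=> [s ps]; have := fE g e.
  rewrite ps e_unit expr1n mulr1 raddf_sum /= -/m => sE.
  rewrite -subr_ge0 -sE; apply: sumr_ge0 => q _.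
  by rewrite rmorphXn /= sqr_ge0.
(* From 2 to 3 variables the condition reads [0 <= 0], from 3 to 4 it reads [11 / 2 <= 6]. *)
have sos4 : sos_ratio 4 (1 : R).
  apply: (@sos_ratio_step R 3 (1 / 2)); [lra|lra|lra|].
  by apply: (@sos_ratio_step R 2 0); [lra|lra|lra|exact: sos_ratio2].
have sos_lb : 2 * m - M <= sos_min 2 p.
  apply: ub_le_sup; first by exists m => g /sos_ub.
  (* With these bounds for [p - (2 m - M) |x| ^ 4] the condition for [k = 1] is an equality. *)
  apply/sosfun_is_sos/(sos4 _ (M - m) (2 * (M - m))).
  - apply: (@quartic_ext _ _ (fun x => f x + - (2 * m - M) * dot x x ^+ 2)).
      by move=> x; rewrite fE mulNr.
    apply: quarticD => //; apply/quarticZ/quartic_sqr => ?.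
      exact: dot_scalar.
    exact: dot_scalarr.
  - move=> x x1; rewrite fE x1 expr1n mulr1.
    by have := e_min x x1; have := f_le x x1; lra.
  - by rewrite subr_ge0 ltW.
  - by lra.
by rewrite /gap minE maxE ler_pdivrMr ?subr_gt0 //; lra.
Qed.
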